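(* Let $\mathfrak p$ be a property of ordered [respectively unordered] hypergraphs without empty edges that is invariant with respect to $\gamma$-decompositions, and let $m\ge1$, $n\ge2$ be integers. Let $\alpha_{\mathfrak p}(m,n)$ be the number of all $(m,n)$-hypergraphs having property $\mathfrak p$, let $\omega_{\mathfrak p}(m,n)$ be the number of all connected $(m,n)$-hypergraphs having property $\mathfrak p$, and let $\alpha'_{\mathfrak p}(m,n)$ be the number of all $(m,n)$-hypergraphs having property $\mathfrak p$ in which the first vertex $V[1]$ is isolated. Then $$\omega_{\mathfrak p}(m,n)=\alpha_{\mathfrak p}(m,n)-\alpha'_{\mathfrak p}(m,n)-\sum_{i=1}^m\sum_{j=1}^{n-1}\hat\nu_{\mathfrak p}(m,i)\binom{n-1}{j-1}\alpha_{\mathfrak p}(m-i,n-j)\,\omega_{\mathfrak p}(i,j),$$ where $\hat\nu_{\mathfrak p}(m,i)=\binom{m}{i}$ if $\mathfrak p$ is a property of ordered hypergraphs, and $\hat\nu_{\mathfrak p}(m,i)=1$ if $\mathfrak p$ is a property of unordered hypergraphs.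
   Context: A (labelled) $(m,n)$-hypergraph $H$ ($m\ge0$, $n\ge1$) consists of a linearly ordered vertex set $V=\{V[1]<\dots<V[n]\}$ together with a finite family of $m$ subsets of $V$, called edges, which may repeat. $H$ is ordered if the family is a sequence (its index set is linearly ordered), and unordered if the family is considered up to re-indexing (a multiset of $m$ subsets of $V$). Two hypergraphs are identified if the order-preserving bijection of their vertex sets carries one family to the other, so one counts $(m,n)$-hypergraphs on a fixed linearly ordered $n$-set. A hypergraph property is a property invariant under this identification. In this statement $\mathfrak p$ is a property of hypergraphs without empty edges, i.e. every hypergraph with property $\mathfrak p$ has no empty edge. A vertex is isolated if it belongs to no edge. A path connecting vertices $u,v$ (equal or different) is either an edge containing both, or a finite sequence $e_1,\dots,e_k$, $k\ge2$, of different edges (members of the family) with $u\in e_1$, $v\in e_k$ and $e_i\cap e_{i+1}\ne\emptyset$ for all $1\le i\le k-1$. $H$ is connected if every two vertices (equal or different) are connected by a path. For $V'\subseteq V$ non-empty, $H[V']$ is the hypergraph with vertex set $V'$ (with induced order) whose edges are exactly those members $e_\lambda$ of the family with $e_\lambda\subseteq V'$ (in the ordered case, with the induced order of indices). Let $H$ be a hypergraph without empty edges, and suppose $V=V_1\cup V_2$ with $V_1\cap V_2=\emptyset$, $V_1,V_2$ non-empty, such that every edge is contained in $V_1$ or in $V_2$; put $H_1=H[V_1]$, $H_2=H[V_2]$. The pair $(H_1,H_2)$ is a $\gamma$-decomposition of $H$, written $H=H_1\lor H_2$, if $H_1$ is connected. The property $\mathfrak p$ is invariant with respect to $\gamma$-decompositions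 if, whenever $H=H_1\lor H_2$, $H$ has property $\mathfrak p$ if and only if both $H_1$ and $H_2$ have property $\mathfrak p$. *)

(* Defs.v *)
From HB Require Import structures.
From mathcomp Require Import all_boot all_order.
From mathcomp Require Import boolp.

Set Implicit Arguments.
Unset Strict Implicit.
Unset Printing Implicit Defensive.

Import Order.TTheory.

(* The family of edges is always stored as a sequence; for unordered
   hypergraphs it only matters up to [same_family Unordered]. Vertex sets are
   meant to be nonempty: the vertexless hypergraphs also inhabit this type, but
   [hypergraph_property], [without_empty_edges] and [gamma_invariant] do not
   constrain a property on them. *)
Record hypergraph := Hypergraph {
  disp : Order.disp_t;
  vert : finOrderType disp;
  edges : seq {set vert} }.
Arguments Hypergraph {disp} vert edges.

Inductive kind := Ordered | Unordered.

Definition same_family (k : kind) (T : eqType) (s t : seq T) : bool :=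
  match k with
  | Ordered => s == t
  | Unordered => perm_eq s t
  end.

Definition identified (k : kind) (H K : hypergraph) : Prop :=
  exists f : vert H -> vert K,
    [/\ bijective f,
        {mono f : x y / (x <= y)%O} &
        same_family k (edges K) [seq f @: e | e : {set vert H} <- edges H]].

Definition no_empty_edge (H : hypergraph) : Prop := set0 \notin edges H.

Definition isolated (H : hypergraph) (v : vert H) : Prop :=
  forall e, e \in edges H -> v \notin e.

Definition first_isolated (H : hypergraph) : Prop :=
  exists v : vert H, (forall u, (v <= u)%O) /\ isolated v.

(* Members of the family are indexed, so repeated edges are different. *)
Definition edge (H : hypergraph) (i : 'I_(size (edges H))) : {set vert H} :=
  tnth (in_tuple (edges H)) i.
Arguments edge {H} i.

Definition path_connected (H : hypergraph) (u v : vert H) : Prop :=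
  (exists i, u \in edge i /\ v \in edge i) \/
  (exists (i : 'I_(size (edges H))) (s : seq 'I_(size (edges H))),
     [/\ (1 <= size s)%N, uniq (i :: s), u \in edge i, v \in edge (last i s) &
         path (fun a b => edge a :&: edge b != set0) i s]).

Definition connected (H : hypergraph) : Prop :=
  forall u v : vert H, path_connected u v.

HB.instance Definition _ (d : Order.disp_t) (V : finOrderType d) (A : {set V}) :=
  [SubChoice_isSubOrder of {x : V | x \in A} by <: with d].

Definition induced (H : hypergraph) (A : {set vert H}) : hypergraph :=
  Hypergraph {x : vert H | x \in A}
    [seq [set x : {x : vert H | x \in A} | val x \in e]
       | e : {set vert H} <- [seq e : {set vert H} <- edges H | e \subset A]].

Definition gamma_decomposition (H : hypergraph) (V1 V2 : {set vert H}) : Prop :=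
  [/\ no_empty_edge H,
      V1 :|: V2 = [set: vert H] /\ V1 :&: V2 = set0,
      V1 != set0 /\ V2 != set0,
      forall e, e \in edges H -> (e \subset V1) || (e \subset V2) &
      connected (induced V1)].

Definition hypergraph_property (k : kind) (p : hypergraph -> Prop) : Prop :=
  forall H K, (0 < #|vert H|)%N -> identified k H K -> (p H <-> p K).

Definition without_empty_edges (p : hypergraph -> Prop) : Prop :=
  forall H, (0 < #|vert H|)%N -> p H -> no_empty_edge H.

Definition gamma_invariant (p : hypergraph -> Prop) : Prop :=
  forall (H : hypergraph) (V1 V2 : {set vert H}), gamma_decomposition V1 V2 ->
    (p H <-> p (induced V1) /\ p (induced V2)).

(* The only order-preserving bijection of 'I_n is the identity, so hypergraphs
   on 'I_n are identified exactly when their families are the same; what is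
   counted are the classes of families under [same_family k]. *)
Definition count_hypergraphs
    (k : kind) (q : hypergraph -> Prop) (m n : nat) : nat :=
  #|equivalence_partition (fun s t : m.-tuple {set 'I_n} => same_family k s t)
      [set t : m.-tuple {set 'I_n} | `[< q (Hypergraph 'I_n t) >]]|.

Definition alpha (k : kind) (p : hypergraph -> Prop) (m n : nat) : nat :=
  count_hypergraphs k p m n.

Definition omega (k : kind) (p : hypergraph -> Prop) (m n : nat) : nat :=
  count_hypergraphs k (fun H => connected H /\ p H) m n.

Definition alpha' (k : kind) (p : hypergraph -> Prop) (m n : nat) : nat :=
  count_hypergraphs k (fun H => p H /\ first_isolated H) m n.

Definition nu (k : kind) (m i : nat) : nat :=
  match k with
  | Ordered => 'C(m, i)
  | Unordered => 1
  end.

(* Main.v *)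
(** Write each number of classes as the sum over all families of the inverse of
the size of the class: in this weighted form the unordered case is as
multiplicative as the ordered one. A hypergraph with property [p] whose first
vertex is not isolated is determined by the component [C] of that vertex and by
its traces on [C] and on the complement of [C], which form a gamma-decomposition
unless [C] is the whole vertex set (the connected case). Splitting a family of
[m] edges into the [i] edges inside [C] and the other ones contributes a factor
['C(m, i)], which in the unordered case is cancelled by the quotient of the
sizes of the classes. *)

Require Import Defs.
From mathcomp Require Import all_boot all_order ssralg ssrnum ssrint rat.
From mathcomp Require Import boolp ring.

Set Implicit Arguments.
Unset Strict Implicit.
Unset Printing Implicit Defensive.

Import Order.TTheory GRing.Theory Num.Theory.

Local Open Scope ring_scope.

(** * Counting classes by weights *)

(** The weights within one class add up to 1. Closure of [D] under [r] ensures that a class meeting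
    [D] lies in [D], so the weight may refer to the class in all of [T]. *)
Lemma card_equivalence_partition (T : finType) (r : rel T) (D : {set T}) :
  equivalence_rel r -> (forall x y, r x y -> x \in D -> y \in D) ->
  #|equivalence_partition r D|%:R
    = \sum_(x in D) #|[set y | r x y]|%:R^-1 :> rat.
Proof.
move=> rE Dr.
have rP : {in D & &, equivalence_rel r} by move=> x y z _ _ _; exact: rE.
rewrite (set_partition_big _ (equivalence_partitionP rP)) -sum1_card natr_sum.
apply: eq_bigr => _ /imsetP[x xD ->].
have rx y : r x y -> [set z in D | r x z] = [set z | r y z].
  move=> xy; apply/setP => z; rewrite !inE -((rE x y z).2 xy) andb_idl //.
  by move=> /Dr; apply.
have xx : r x x := (rE x x x).1.
rewrite (eq_bigr (fun=> #|[set z in D | r x z]|%:R^-1)); last first.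
  by move=> y; rewrite !inE => /andP[_ /rx ->].
rewrite sumr_const -[RHS]mulr_natl divff // pnatr_eq0 -lt0n.
by apply/card_gt0P; exists x; rewrite !inE xD.
Qed.

(** * Sums over families of fixed length *)

Lemma big_tuple_cons (R : nmodType) (T : finType) {m} (P : pred (seq T))
    (F : seq T -> R) :
  \sum_(t : m.+1.-tuple T | P t) F t
    = \sum_(x : T) \sum_(t : m.-tuple T | P (x :: t)) F (x :: t).
Proof.
rewrite pair_big_dep /=.
rewrite (reindex (fun u : T * m.-tuple T => [tuple of u.1 :: u.2])) //=.
exists (fun t : m.+1.-tuple T => (thead t, [tuple of behead t]))
  => [[x t] _|t _] /=.
  by congr pair; apply: val_inj.
by rewrite [RHS]tuple_eta.
Qed.

Lemma big_tuple0 (R : nmodType) (T : finType) (P : pred (seq T))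
    (F : seq T -> R) :
  \sum_(t : 0.-tuple T | P t) F t = if P [::] then F [::] else 0.
Proof.
rewrite big_mkcond (big_pred1 [tuple]) //= => t.
by apply/esym/eqP; rewrite tuple0.
Qed.

(** A tuple amounts to its two filtered parts and the positions of the entries in [A]. Induction on
    [m] follows Pascal's rule, according to whether the head lies in [A]; [F] and [G] vary so as to
    absorb the head. *)
Lemma big_tuple_filter (R : comPzSemiRingType) (T : finType) (A : pred T)
    (F G : seq T -> R) m i :
  \sum_(t : m.-tuple T | count A t == i) F (filter A t) * G (filter (predC A) t)
  = 'C(m, i)%:R * ((\sum_(t : i.-tuple T | all A t) F t)
      * (\sum_(t : (m - i).-tuple T | all (predC A) t) G t)).
Proof.
elim: m i F G => [|m IHm] i F G.
  rewrite (big_tuple0 (fun t : seq T => count A t == i)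
            (fun t : seq T => F (filter A t) * G (filter (predC A) t))) /=.
  case: i => [|i]; last by rewrite bin0n mul0r.
  by rewrite bin0 mul1r big_tuple0 (big_tuple0 (all (predC A))).
rewrite (big_tuple_cons (fun t : seq T => count A t == i)
            (fun t : seq T => F (filter A t) * G (filter (predC A) t))) /=.
rewrite (bigID A) /=.
(* A head in [A] takes one of the [i] places, so nothing arises for [i = 0]. *)
have inA : \sum_(x | A x) \sum_(t : m.-tuple T | (A x + count A t == i)%N)
      F (if A x then x :: filter A t else filter A t)
      * G (if ~~ A x then x :: filter (predC A) t else filter (predC A) t)
   = if i is i'.+1 then 'C(m, i')%:R * ((\sum_(t : i.-tuple T | all A t) F t)
      * (\sum_(t : (m - i').-tuple T | all (predC A) t) G t)) else 0.
  case: i => [|i].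
    by apply: big1 => x ->; rewrite big_pred0.
  rewrite (big_tuple_cons (all A)) big_distrl big_distrr [RHS](bigID A) /=.
  rewrite [X in _ = _ + X]big1 ?addr0; last first.
    move=> x /negbTE xA; rewrite big_pred0 ?mul0r ?mulr0 // => t.
    by rewrite xA.
  apply: eq_bigr => x xA; rewrite xA /=.
  exact: (IHm i (fun t => F (x :: t)) G).
have notinA : \sum_(x | ~~ A x) \sum_(t : m.-tuple T | (A x + count A t == i)%N)
      F (if A x then x :: filter A t else filter A t)
      * G (if ~~ A x then x :: filter (predC A) t else filter (predC A) t)
   = 'C(m, i)%:R * ((\sum_(t : i.-tuple T | all A t) F t)
      * (\sum_(t : (m.+1 - i).-tuple T | all (predC A) t) G t)).
  (* For [i > m] the truncated [m.+1 - i] is no successor, but then both sides vanish. *)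
  have [lt_mi|le_im] := ltnP m i.
    rewrite bin_small // mul0r big1 // => x /negbTE ->.
    rewrite big_pred0 // => t; apply/negbTE; rewrite neq_ltn.
    by rewrite (leq_ltn_trans (count_size _ _)) ?size_tuple.
  rewrite subSn // (big_tuple_cons (all (predC A))) mulrA big_distrr.
  rewrite [RHS](bigID A) /= [X in _ = X + _]big1 ?add0r; last first.
    by move=> x xA; rewrite xA /= [X in _ * X]big_pred0 ?mulr0.
  apply: eq_bigr => x xA; rewrite (negbTE xA) /= -mulrA.
  exact: (IHm i F (fun t => G (x :: t))).
rewrite inA notinA; case: i {inA notinA} => [|i]; first by rewrite add0r !bin0.
by rewrite binS natrD mulrDl addrC subSS.
Qed.

Lemma big_tuple_map (R : nmodType) (T U : finType) (f : T -> U)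
    {m} (P : pred (seq U)) (F : seq U -> R) : injective f ->
  \sum_(t : m.-tuple T | P (map f t)) F (map f t)
    = \sum_(u : m.-tuple U | all [in codom f] u && P u) F u.
Proof.
move=> f_inj; elim: m P F => [|m IHm] P F.
  rewrite (big_tuple0 (fun t => P (map f t)) (fun t => F (map f t))).
  by rewrite (big_tuple0 (fun u => all [in codom f] u && P u)).
rewrite (big_tuple_cons (fun t => P (map f t)) (fun t => F (map f t))).
rewrite (big_tuple_cons (fun u => all [in codom f] u && P u)).
rewrite [RHS](bigID [in codom f]) /= [X in _ = _ + X]big1 ?addr0; last first.
  by move=> u /negbTE uf; rewrite big_pred0 // => t; rewrite uf.
rewrite -big_uniq /=; last by rewrite map_inj_uniq ?enum_uniq.
rewrite big_image /=; apply: eq_bigr => x _.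
rewrite (IHm (fun u => P (f x :: u)) (fun u => F (f x :: u))).
by apply: eq_bigl => u; rewrite codom_f.
Qed.

(** * Sizes of classes of families *)

(** Taking a plain sequence lets filtered and mapped families occur without proofs about their
    length; the value is 0 if the length of [t] is not [m]. *)
Definition class_size (k : kind) (T : finType) m (t : seq T) : nat :=
  \sum_(s : m.-tuple T | same_family k s t) 1.

Lemma same_family_refl k (T : eqType) (t : seq T) : same_family k t t.
Proof. by case: k => /=. Qed.

Lemma same_family_equiv k (T : eqType) : equivalence_rel (@same_family k T).
Proof.
case: k => s t u; split => //=; first by move=> /eqP ->.
by move=> /permPl ->.
Qed.

Lemma same_family_mem k (T : eqType) (s t : seq T) :
  same_family k s t -> s =i t.
Proof. by case: k => [/eqP ->|/perm_mem]. Qed.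

Lemma same_family_map k (T U : eqType) (f : T -> U) (s t : seq T) :
  same_family k s t -> same_family k (map f s) (map f t).
Proof. by case: k => /= [/eqP ->|]; [exact: eqxx | exact: perm_map]. Qed.

Lemma same_family_map_inj k (T U : eqType) (f : T -> U) (s t : seq T) :
  injective f -> same_family k (map f s) (map f t) = same_family k s t.
Proof.
move=> f_inj; apply/idP/idP; last exact: same_family_map.
by case: k => /= [/eqP /(inj_map f_inj) -> //|]; exact: perm_map_inj.
Qed.

Lemma class_size_card k (T : finType) m (t : m.-tuple T) :
  class_size k m t = #|[set s : m.-tuple T | same_family k t s]|.
Proof.
rewrite /class_size sum1_card; apply: eq_card => s; rewrite !inE.
by case: k => /=; [rewrite eq_sym | rewrite perm_sym].
Qed.

Lemma class_size_map k (T U : finType) (f : T -> U) m (t : seq T) :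
  injective f -> class_size k m (map f t) = class_size k m t.
Proof.
move=> f_inj; rewrite /class_size.
transitivity (\sum_(u : m.-tuple U |
    all [in codom f] u && same_family k u (map f t)) 1)%N.
  apply: eq_bigl => u; apply/esym/andb_idl => /same_family_mem eq_ut.
  by apply/allP => y; rewrite eq_ut => /mapP[x _ ->]; exact: codom_f.
rewrite -(big_tuple_map (fun u => same_family k u (map f t)) (fun=> 1%N)) //.
by apply: eq_bigl => s; rewrite same_family_map_inj.
Qed.

Lemma class_size_ordered (T : finType) m (t : m.-tuple T) :
  class_size Ordered m t = 1%N.
Proof. by rewrite /class_size (big_pred1 t). Qed.

Lemma perm_eq_filters (T : eqType) (A : pred T) (s t : seq T) :
  perm_eq s t = perm_eq (filter A s) (filter A t)
    && perm_eq (filter (predC A) s) (filter (predC A) t).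
Proof.
apply/idP/andP => [st|[sA sCA]]; first by split; exact: perm_filter.
by rewrite -(perm_filterC A s) perm_sym -(perm_filterC A t) perm_sym perm_cat.
Qed.

(** A rearrangement of [t] rearranges the part in [A] and the part outside [A] separately and
    chooses the positions of the first: this is [big_tuple_filter] over [nat], for indicator
    functions. *)
Lemma class_size_unordered_filter (T : finType) (A : pred T) m (t : seq T) :
  class_size Unordered m t
    = ('C(m, count A t) * (class_size Unordered (count A t) (filter A t)
       * class_size Unordered (m - count A t) (filter (predC A) t)))%N.
Proof.
(* A necessary condition [P] may serve as the range of summation, with [perm_eq] moved into the
   summand as an indicator. *)
have sizeE j (P : pred (seq T)) (u : seq T) :
    (forall s, perm_eq s u -> P s) ->
  class_size Unordered j u
    = (\sum_(s : j.-tuple T | P s) (perm_eq s u : nat))%N.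
  move=> uP; rewrite /class_size /= big_mkcond [RHS]big_mkcond.
  apply: eq_bigr => s _; have := uP s.
  by case: (perm_eq s u) => [-> //|_]; case: (P s).
rewrite (sizeE m (fun s => count A s == count A t)); last first.
  by move=> s /permP ->.
rewrite (sizeE _ (all A)); last first.
  by move=> s /perm_all ->; exact: filter_all.
rewrite (sizeE _ (all (predC A))); last first.
  by move=> s /perm_all ->; exact: filter_all.
rewrite -[X in (X * _)%N]natn.
apply: (etrans _ (big_tuple_filter A (fun s => perm_eq s (filter A t) : nat)
  (fun s => perm_eq s (filter (predC A) t) : nat) m _)).
by apply: eq_bigr => s _; rewrite (perm_eq_filters A) -mulnb.
Qed.

(** Multiplicativity of the weighted counts, for both kinds at once. *)
Lemma big_class_filter k (T : finType) (A : pred T) (P Q : pred (seq T)) m i :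
  (i <= m)%N ->
  \sum_(t : m.-tuple T |
      [&& count A t == i, P (filter A t) & Q (filter (predC A) t)])
     (class_size k m t)%:R^-1
  = (nu k m i)%:R
    * ((\sum_(t : i.-tuple T | all A t && P t) (class_size k i t)%:R^-1)
      * (\sum_(t : (m - i).-tuple T | all (predC A) t && Q t)
           (class_size k (m - i) t)%:R^-1)) :> rat.
Proof.
move=> le_im.
(* The class of a family is [b] times as large as the product of the classes of
   its two parts. *)
pose b := if k is Ordered then 1%N else 'C(m, i).
have nuE : (nu k m i)%:R = 'C(m, i)%:R / b%:R :> rat.
  rewrite /nu /b; case: (k); rewrite ?invr1 ?mulr1 // divff //.
  by rewrite pnatr_eq0 -lt0n bin_gt0.
(* Extending the weights by 0 moves the conditions [P] and [Q] into the summands, as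
   [big_tuple_filter] requires. *)
pose w j (R : pred (seq T)) (u : seq T) : rat :=
  if R u then (class_size k j u)%:R^-1 else 0.
rewrite nuE mulrAC !big_mkcondr /=.
rewrite -(big_tuple_filter A (w i P) (w (m - i)%N Q)) big_distrl /=.
apply: eq_bigr => t /eqP ti; rewrite /w.
case: (P _); last by rewrite !mul0r.
case: (Q _) => /=; last by rewrite mulr0 mul0r.
have -> : class_size k m t = (b * (class_size k i (filter A t)
    * class_size k (m - i) (filter (predC A) t)))%N.
  rewrite /b; case: (k); last by rewrite (class_size_unordered_filter A) ti.
  have sA : size (filter A t) == i by rewrite size_filter ti.
  have sC : size (filter (predC A) t) == (m - i)%N.
    by rewrite size_filter -(eqn_add2l i) -{1}ti count_predC size_tuple subnKC.
  by rewrite class_size_ordered (class_size_ordered (Tuple sA))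
     (class_size_ordered (Tuple sC)).
by rewrite !natrM !invfM mulrC.
Qed.

(** * Connectedness through the adjacency graph *)

(** Not reflexive: [adj E x x] says that [x] is not isolated. *)
Definition adj (V : finType) (E : seq {set V}) : rel V :=
  fun x y => has (fun e : {set V} => (x \in e) && (y \in e)) E.

Lemma adjP (V : finType) (E : seq {set V}) x y :
  reflect (exists2 e, e \in E & (x \in e) && (y \in e)) (adj E x y).
Proof. exact: hasP. Qed.

Lemma adj_sym (V : finType) (E : seq {set V}) : symmetric (adj E).
Proof. by move=> x y; apply: eq_has => e; rewrite andbC. Qed.

Lemma adj_edge (H : hypergraph) (x y : vert H) :
  adj (edges H) x y <-> exists i, x \in edge i /\ y \in edge (H := H) i.
Proof.
split=> [/adjP[e eH /andP[xe ye]]|[i [xi yi]]].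
  have ltiH : (index e (edges H) < size (edges H))%N by rewrite index_mem.
  by exists (Ordinal ltiH); rewrite /edge (tnth_nth e) /= nth_index.
by apply/adjP; exists (edge i); rewrite ?xi ?yi ?mem_tnth.
Qed.

Lemma isolatedE (H : hypergraph) (v : vert H) :
  isolated v <-> ~~ adj (edges H) v v.
Proof.
split=> [vH|/hasPn vH e /vH].
  by apply/hasPn => e /vH /negbTE ->.
by rewrite andbb.
Qed.

(** Chains of edges and walks of vertices translate into each other. Since [connect] is reflexive,
    the empty walk at an isolated vertex has to be excluded by [adj (edges H) u u]. *)
Lemma path_connectedE (H : hypergraph) (u v : vert H) :
  path_connected u v <-> adj (edges H) u u && connect (adj (edges H)) u v.
Proof.
split.
  case=> [[i [ui vi]]|[i [s [_ _ ui vs ps]]]]; apply/andP.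
    by split; [apply/adj_edge; exists i | apply/connect1/adj_edge; exists i].
  split; first by apply/adj_edge; exists i.
  elim: s i u ui vs ps => [|j s IHs] i u ui /= vs.
    by move=> _; apply/connect1/adj_edge; exists i.
  move=> /andP[/set0Pn[x /setIP[xi xj]] /(IHs _ x xj vs)]; apply: connect_trans.
  by apply/connect1/adj_edge; exists i.
move=> /andP[uu /connectP[q pq ->]].
pose meet (a b : 'I_(size (edges H))) := edge a :&: edge b != set0.
have [i [s [ui vs ps]]] : exists i s, [/\ u \in edge i,
    last u q \in edge (last i s) & path meet i s].
  elim: q u uu pq => [|x q IHq] u uu /=.
    by case/adj_edge: uu => i [ui _]; exists i, [::].
  case/andP=> ux /IHq[|j [s [xj vs ps]]].
    by case/adjP: ux => e eH /andP[_ xe]; apply/adjP; exists e; rewrite ?xe.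
  case/adj_edge: ux => i [ui xi]; exists i, (j :: s); split=> //=.
  by rewrite ps andbT; apply/set0Pn; exists x; rewrite inE xi.
(* Shortening the chain makes its edges different and keeps both ends; a single remaining edge is
   the first case of [path_connected]. *)
move: vs; case/shortenP: ps => -[|j s'] ps us _ vs; first by left; exists i.
by right; exists i, (j :: s').
Qed.

Lemma connected_baseP (H : hypergraph) (v0 : vert H) :
  connected H <->
  adj (edges H) v0 v0 /\ forall v, connect (adj (edges H)) v0 v.
Proof.
split=> [cH|[v00 cv0] u v].
  by split=> [|v]; [have := cH v0 v0 | have := cH v0 v];
    rewrite path_connectedE => /andP[].
have adj_connect_sym := sym_connect_sym (@adj_sym _ (edges H)).
apply/path_connectedE/andP; split; last first.
  by rewrite (connect_trans _ (cv0 v)) // adj_connect_sym.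
(* Either [u] is [v0], or the first step of a walk from [u] to [v0] puts [u] in an edge. *)
have: connect (adj (edges H)) u v0 by rewrite adj_connect_sym.
case/connectP=> -[_ /= <- //|x q /= /andP[/adjP[e eH /andP[ue _]] _] _].
by apply/adjP; exists e; rewrite ?ue.
Qed.

Lemma homo_connect (T U : finType) (e : rel T) (e' : rel U) (f : T -> U) x y :
  (forall a b, e a b -> e' (f a) (f b)) ->
  connect e x y -> connect e' (f x) (f y).
Proof.
move=> ef /connectP[q pq ->]; elim: q x pq => [|z q IHq] x //=.
by case/andP=> /ef/connect1 xz /IHq; apply: connect_trans.
Qed.

Lemma identified_adj k (H K : hypergraph) (f : vert H -> vert K) :
  injective f ->
  same_family k (edges K) [seq f @: e | e : {set vert H} <- edges H] ->
  forall x y, adj (edges K) (f x) (f y) = adj (edges H) x y.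
Proof.
move=> f_inj /same_family_mem fE x y; rewrite /adj (eq_has_r fE) has_map.
by apply: eq_has => e /=; rewrite !mem_imset.
Qed.

Lemma connected_property k : hypergraph_property k connected.
Proof.
move=> H K /card_gt0P[v0 _] [f [[g fK gK] _ fE]].
have fA := identified_adj (can_inj fK) fE.
rewrite (connected_baseP v0) (connected_baseP (f v0)) fA.
split=> -[v00 cv0]; split=> // v.
  by rewrite -(gK v); apply: homo_connect (cv0 (g v)) => x y; rewrite fA.
rewrite -(fK v0) -(fK v); apply: homo_connect (cv0 (f v)) => x y.
by rewrite -fA !gK.
Qed.

Lemma first_isolated_property k : hypergraph_property k first_isolated.
Proof.
move=> H K _ [f [[g fK gK] f_mono fE]].
have fA := identified_adj (can_inj fK) fE.
split=> -[v [v_min /isolatedE v_iso]].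
  exists (f v); split; last by apply/isolatedE; rewrite fA.
  by move=> u; rewrite -(gK u) f_mono.
exists (g v); split; last by apply/isolatedE; rewrite -fA gK.
by move=> u; rewrite -f_mono gK.
Qed.

Lemma and_property k (p q : hypergraph -> Prop) :
  hypergraph_property k p -> hypergraph_property k q ->
  hypergraph_property k (fun H => p H /\ q H).
Proof.
move=> pP qP H K H0 HK; have := pP _ _ H0 HK; have := qP _ _ H0 HK.
by tauto.
Qed.

(** * Weighted counts on arbitrary vertex sets *)

Lemma identified_same_family k d (V : finOrderType d) (s t : seq {set V}) :
  same_family k t s -> identified k (Hypergraph V s) (Hypergraph V t).
Proof.
move=> st; exists id; split=> //; first by exists id.
by rewrite (eq_map (@imset_id _)) map_id.
Qed.

Lemma count_hypergraphs_ord k q m n : hypergraph_property k q -> (0 < n)%N ->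
  (count_hypergraphs k q m n)%:R
    = \sum_(t : m.-tuple {set 'I_n} | `[< q (Hypergraph 'I_n t) >])
        (class_size k m t)%:R^-1 :> rat.
Proof.
move=> qP n_gt0; rewrite /count_hypergraphs card_equivalence_partition.
- apply: eq_big => [t|t _]; first by rewrite inE.
  by rewrite class_size_card.
- by move=> s t u; exact: (@same_family_equiv k _ s t u).
move=> s t st; rewrite !inE => /asboolP qs; apply/asboolP.
have V_gt0 : (0 < #|'I_n|)%N by rewrite card_ord.
by apply/(qP (Hypergraph 'I_n t) (Hypergraph 'I_n s)) => //;
  exact: identified_same_family.
Qed.

(** The increasing enumeration of [V] is an identification; on edges it acts injectively, which
    preserves class sizes. *)
Lemma count_hypergraphs_vert k q m d (V : finOrderType d) :
  hypergraph_property k q -> (0 < #|V|)%N ->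
  (count_hypergraphs k q m #|V|)%:R
    = \sum_(t : m.-tuple {set V} | `[< q (Hypergraph V t) >])
        (class_size k m t)%:R^-1 :> rat.
Proof.
move=> qP V_gt0; rewrite count_hypergraphs_ord //.
pose g : 'I_#|V| -> V := Order.enum_val.
have g_bij : bijective g := Order.enum_val_bij V.
pose f (e : {set 'I_#|V|}) := g @: e.
have f_inj : injective f by exact/imset_inj/bij_inj.
transitivity (\sum_(t : m.-tuple {set V} | all [in codom f] t &&
    `[< q (Hypergraph V t) >]) (class_size k m t)%:R^-1 : rat); last first.
  (* Taking images under the bijection [g] is onto, so the condition on the codomain is void. *)
  apply: eq_bigl => t; apply/andb_idl => _; apply/allP => e _.
  have [h gK hK] := g_bij.
  apply/codomP; exists (h @: e); rewrite /f -imset_comp -[LHS]imset_id.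
  by apply: eq_imset => x; rewrite /= hK.
rewrite -(big_tuple_map (fun t => `[< q (Hypergraph V t) >])
            (fun t => (class_size k m t)%:R^-1)) //.
apply: eq_big => [t|t _]; last by rewrite class_size_map.
apply: asbool_equiv_eq; apply: qP; first by rewrite card_ord.
exists g; split=> //; last exact: same_family_refl.
by apply: Order.le_enum_val; exact: le_total.
Qed.

(** This is the map that [induced] applies to the edges inside [C]. *)
Definition trace_edge (V : finType) (C e : {set V}) : {set {x : V | x \in C}} :=
  [set x | val x \in e].

Lemma trace_edgeK (V : finType) (C : {set V}) (e : {set {x : V | x \in C}}) :
  trace_edge C (val @: e) = e.
Proof. by apply/setP => x; rewrite inE mem_imset //; exact: val_inj. Qed.

Lemma imset_val_trace (V : finType) (C e : {set V}) :
  e \subset C -> val @: trace_edge C e = e.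
Proof.
move=> eC; apply/setP => x; apply/imsetP/idP => [[y]|xe].
  by rewrite inE => ye ->.
by exists (Sub x (subsetP eC x xe)); rewrite ?inE SubK.
Qed.

(** Taking images under [val] and taking traces are inverse bijections between the subsets of the
    subtype and the subsets of [V] inside [C]. *)
Lemma count_hypergraphs_induced k q m d (V : finOrderType d) (C : {set V}) :
  hypergraph_property k q -> C != set0 ->
  \sum_(t : m.-tuple {set V} | all (fun e : {set V} => e \subset C) t &&
      `[< q (Hypergraph {x : V | x \in C} (map (trace_edge C) t)) >])
     (class_size k m t)%:R^-1
  = (count_hypergraphs k q m #|C|)%:R :> rat.
Proof.
move=> qP C0; rewrite -card_sig count_hypergraphs_vert //; last first.
  by rewrite card_sig card_gt0.
pose f (e : {set {x : V | x \in C}}) : {set V} := val @: e.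
have f_inj : injective f by exact/imset_inj/val_inj.
under [RHS]eq_bigr do rewrite -(class_size_map _ _ _ f_inj).
pose Q s := `[< q (Hypergraph {x : V | x \in C} (map (trace_edge C) s)) >].
(* Writing [t] as the trace of its image makes the condition a predicate of [map f t], as
   [big_tuple_map] requires. *)
under [RHS]eq_bigl => t.
  rewrite -[tval t]map_id -(eq_map (@trace_edgeK _ C)) map_comp.
  rewrite -/f -/(Q (map f t)).
  over.
rewrite (big_tuple_map Q (fun t => (class_size k m t)%:R^-1)) //.
apply: eq_bigl => t; congr andb; apply: eq_all => e.
apply/idP/codomP => [/imset_val_trace <-|[e' ->]]; first by eexists.
by apply/subsetP => _ /imsetP[y _ ->]; exact: valP.
Qed.

(** * Components and gamma-decompositions *)

Lemma adj_induced (H : hypergraph) (C : {set vert H}) (x y : vert (induced C)) :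
  adj (edges (induced C)) x y =
  has (fun e : {set vert H} =>
         (e \subset C) && ((val x \in e) && (val y \in e)))
    (edges H).
Proof.
rewrite /adj /= has_map has_filter -filter_predI -has_filter.
by apply: eq_has => e; rewrite /= !inE andbC.
Qed.

(** An edge that meets the component of [v0] lies in it, and so do walks from [v0]. Conversely,
    walks cannot leave a set that no edge crosses. *)
Lemma component_split (H : hypergraph) (v0 : vert H) (C : {set vert H}) :
  v0 \in C ->
  adj (edges H) v0 v0 /\ [set v | connect (adj (edges H)) v0 v] = C <->
  (forall e, e \in edges H -> (e \subset C) || (e \subset ~: C))
  /\ connected (induced C).
Proof.
move=> v0C; split=> [[v00 CE]|[splitC]]; last first.
  move=> /(connected_baseP (H := induced C) (Sub v0 v0C))[v00 cC].
  have adjI x y :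
      adj (edges (induced C)) x y -> adj (edges H) (val x) (val y).
    by rewrite adj_induced => /hasP[e eH /andP[_ xy]]; apply/adjP; exists e.
  split; first by have := adjI _ _ v00; rewrite !SubK.
  apply/setP => v; rewrite inE; apply/idP/idP => [v0v|vC]; last first.
    by have := homo_connect adjI (cC (Sub v vC)); rewrite !SubK.
  have closedC : closed (adj (edges H)) C.
    move=> x y /adjP[e /splitC /orP[] /subsetP eC /andP[/eC + /eC]].
      by move=> -> ->.
    by rewrite !inE => /negbTE -> /negbTE ->.
  by rewrite -(closed_connect closedC v0v).
have adjC x y : x \in C -> adj (edges H) x y -> y \in C.
  by rewrite -CE !inE => v0x /connect1; exact: connect_trans.
have subC e x : e \in edges H -> x \in e -> x \in C -> e \subset C.
  move=> eH xe xC; apply/subsetP => y ye; apply: adjC xC _.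
  by apply/adjP; exists e; rewrite ?xe.
split=> [e eH|].
  case: (boolP (e \subset ~: C)) => [|/subsetPn[x xe]]; first by rewrite orbT.
  by rewrite inE negbK => xC; rewrite (subC _ x).
apply/(connected_baseP (H := induced C) (Sub v0 v0C)).
have adjI x y (xC : x \in C) (yC : y \in C) :
    adj (edges H) x y -> adj (edges (induced C)) (Sub x xC) (Sub y yC).
  case/adjP=> e eH /andP[xe ye]; rewrite adj_induced.
  by apply/hasP; exists e => //; rewrite !SubK xe ye (subC _ x).
split=> [|v]; first exact: adjI.
have: val v \in [set v | connect (adj (edges H)) v0 v] by rewrite CE (valP v).
(* The walk is lifted to the subtype step by step, with its starting point in [C] generalized. *)
rewrite inE => /connectP[q]; elim: q v0 v0C {v00 CE} => [|y q IHq] x xC /=.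
  by move=> _ vx; rewrite [X in connect _ X v](_ : _ = v) //; apply: val_inj.
case/andP=> xy yq vE; have yC := adjC _ _ xC xy.
by rewrite (connect_trans (connect1 (adjI _ _ xC yC xy))) ?IHq.
Qed.

(** The right-hand side separates the variables: its first half depends only on the edges inside
    [C], its second half only on the others. This makes the sum over families factor. *)
Lemma gamma_component (p : hypergraph -> Prop) d (V : finOrderType d)
    (s : seq {set V}) (v0 : V) (C : {set V}) :
  without_empty_edges p -> gamma_invariant p ->
  v0 \in C -> C != setT ->
  [/\ p (Hypergraph V s), adj s v0 v0 & [set v | connect (adj s) v0 v] = C] <->
  (connected (induced (H := Hypergraph V s) C)
    /\ p (induced (H := Hypergraph V s) C)) /\
  (all (fun e : {set V} => e \subset ~: C)
       [seq e : {set V} <- s | ~~ (e \subset C)]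
    /\ p (Hypergraph {x : V | x \in ~: C}
           (map (trace_edge (~: C)) [seq e : {set V} <- s | ~~ (e \subset C)]))).
Proof.
move=> p_no_empty p_gamma v0C CT; pose H := Hypergraph V s.
have CC0 : ~: C != set0 by rewrite -setCT (inj_eq (@setC_inj _)).
have C0 : C != set0 by apply/set0Pn; exists v0.
have V_gt0 : (0 < #|vert H|)%N by apply/card_gt0P; exists v0.
have decomp : no_empty_edge H ->
    (forall e, e \in edges H -> (e \subset C) || (e \subset ~: C)) ->
    connected (induced (H := H) C) ->
    gamma_decomposition (H := H) C (~: C)
    /\ induced (H := H) (~: C) = Hypergraph {x : V | x \in ~: C}
           (map (trace_edge (~: C)) [seq e : {set V} <- s | ~~ (e \subset C)]).
  move=> H0 splitC cC; split; first by split; rewrite ?setUCr ?setICr.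
  rewrite /induced /=; congr (Hypergraph _ (map _ _)).
  (* Without empty edges, no edge lies in both [C] and [~: C]. *)
  apply: eq_in_filter => e es; apply/idP/idP => [eCC|]; last first.
    by have := splitC e es => /orP[->|].
  apply: contra H0 => eC; suff <- : e = set0 by [].
  by apply/eqP; rewrite -subset0 -(setICr C) subsetI eC.
split.
  case=> pH v00 CE; have H0 := p_no_empty _ V_gt0 pH.
  have [splitC cC] := (component_split (H := H) v0C).1 (conj v00 CE).
  have [gC <-] := decomp H0 splitC cC; have [pC pCC] := (p_gamma _ _ _ gC).1 pH.
  split=> //; split=> //; apply/allP => e; rewrite mem_filter => /andP[eC es].
  by have := splitC e es; rewrite (negbTE eC).
case=> -[cC pC] [/allP sCC pCC].
have splitC e : e \in s -> (e \subset C) || (e \subset ~: C).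
  move=> es; case: (boolP (e \subset C)) => //= eC.
  by apply: sCC; rewrite mem_filter eC.
(* An empty edge of [H] would lie inside [C] and leave an empty trace there, against [pC]. *)
have H0 : no_empty_edge H.
  apply/negP => s0; have : no_empty_edge (induced (H := H) C).
    by apply: p_no_empty pC; rewrite card_sig card_gt0.
  move/negP; apply; apply/mapP; exists set0.
    by rewrite mem_filter sub0set.
  by apply/setP => x; rewrite !inE.
have [gC CCE] := decomp H0 splitC cC.
have [v00 CE] := (component_split (H := H) v0C).2 (conj splitC cC).
by split=> //; apply/(p_gamma _ _ _ gC); rewrite CCE.
Qed.

(** * The recurrence *)

(** Without edges every vertex is isolated. This is why the sum over [i] may start at 1. *)
Lemma count_connected0 k p n : hypergraph_property k p -> (0 < n)%N ->
  omega k p 0 n = 0%N.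
Proof.
move=> pP n_gt0; apply/eqP; rewrite -(pnatr_eq0 rat); apply/eqP.
rewrite count_hypergraphs_ord //.
  apply: big_pred0 => t; apply/asboolP => -[].
  move=> /(connected_baseP (H := Hypergraph 'I_n t) (Ordinal n_gt0)).
  by rewrite tuple0 => -[].
by apply: and_property pP; exact: connected_property.
Qed.

(** Adding [x] is a bijection from the [j]-element subsets of the complement of [x]. *)
Lemma card_sets_containing (T : finType) (x : T) j :
  #|[set C : {set T} | (x \in C) && (#|C| == j.+1)]| = 'C(#|T|.-1, j).
Proof.
rewrite -(cardsC1 x) -cards_draws.
rewrite -[RHS](card_in_imset (f := fun D : {set T} => x |: D)); last first.
  move=> D E; rewrite !inE => /andP[xD _] /andP[xE _].
  move/(congr1 (fun A => A :\ x)); rewrite !setU1K //.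
    by apply/negP => /(subsetP xE); rewrite !inE eqxx.
  by apply/negP => /(subsetP xD); rewrite !inE eqxx.
apply: eq_card => C; rewrite inE; apply/andP/imsetP => [[xC /eqP Cj]|[D]].
  exists (C :\ x); last by rewrite setD1K.
  by rewrite inE subsetDr /= -eqSS -Cj (cardsD1 x C) xC.
rewrite inE => /andP[xD /eqP <-] ->; rewrite setU11 cardsU1.
by split=> //; case: (boolP (x \in D)) => // /(subsetP xD); rewrite !inE eqxx.
Qed.

(** The contribution of a fixed proper component [C] of the first vertex, split by the number [i] of
    edges inside [C]. *)
Lemma sum_component k p m n (C : {set 'I_n.+1}) :
  hypergraph_property k p -> without_empty_edges p -> gamma_invariant p ->
  ord0 \in C -> C != setT ->
  \sum_(t : m.-tuple {set 'I_n.+1} |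
      (`[< p (Hypergraph 'I_n.+1 t) >] && adj t ord0 ord0)
      && ([set v | connect (adj t) ord0 v] == C)) (class_size k m t)%:R^-1
  = \sum_(1 <= i < m.+1) (nu k m i * alpha k p (m - i) (n.+1 - #|C|)
      * omega k p i #|C|)%:R :> rat.
Proof.
move=> p_property p_no_empty p_gamma C_ord0 CT.
pose A (e : {set 'I_n.+1}) := e \subset C.
pose P1 s := `[< connected (Hypergraph _ (map (trace_edge C) s))
  /\ p (Hypergraph _ (map (trace_edge C) s)) >].
pose P2 s := all (fun e : {set 'I_n.+1} => e \subset ~: C) s &&
  `[< p (Hypergraph {x | x \in ~: C} (map (trace_edge (~: C)) s)) >].
have C0 : C != set0 by apply/set0Pn; exists ord0.
have CC0 : ~: C != set0 by rewrite -setCT (inj_eq (@setC_inj _)).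
have cardC : #|~: C| = (n.+1 - #|C|)%N by rewrite cardsCs setCK card_ord.
have cond (t : m.-tuple {set 'I_n.+1}) :
    (`[< p (Hypergraph 'I_n.+1 t) >] && adj t ord0 ord0)
    && ([set v | connect (adj t) ord0 v] == C)
  = P1 (filter A t) && P2 (filter (predC A) t).
  have gammaE := @gamma_component p _ 'I_n.+1 t ord0 C p_no_empty p_gamma
    C_ord0 CT.
  apply/idP/idP.
    case/andP=> /andP[/asboolP pt t00 /eqP tC].
    have [PC [allC PCC]] := gammaE.1 (And3 pt t00 tC).
    by rewrite /P1 /P2 allC; apply/andP; split; apply/asboolP.
  case/andP=> /asboolP PC /andP[allC /asboolP PCC].
  have [pt -> /eqP tC] := gammaE.2 (conj PC (conj allC PCC)).
  by rewrite tC !andbT; apply/asboolP.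
under eq_bigl => t do rewrite cond.
have countA (t : m.-tuple {set 'I_n.+1}) : (count A t < m.+1)%N.
  by rewrite ltnS -{2}(size_tuple t) count_size.
rewrite (partition_big (fun t : m.-tuple _ => Ordinal (countA t)) xpredT) //=.
(* The term for [i = 0] vanishes by [count_connected0], as [C] is not empty. *)
transitivity (\sum_(i < m.+1) (nu k m i * alpha k p (m - i) (n.+1 - #|C|)
      * omega k p i #|C|)%:R : rat); last first.
  rewrite -(big_mkord xpredT
    (fun i => (nu k m i * alpha k p (m - i) (n.+1 - #|C|)
      * omega k p i #|C|)%:R)) big_ltn // count_connected0 ?card_gt0 //.
  by rewrite muln0 add0r.
apply: eq_bigr => i _.
rewrite (eq_bigl (fun t : m.-tuple _ => [&& count A t == i, P1 (filter A t)
    & P2 (filter (predC A) t)])); last by move=> t; rewrite andbC.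
have le_im : (i <= m)%N by rewrite -ltnS.
rewrite (big_class_filter k A P1 P2 le_im).
rewrite /alpha -cardC !natrM -mulrA; congr (_ * _).
rewrite mulrC; congr (_ * _).
  rewrite -count_hypergraphs_induced //; apply: eq_bigl => t.
  rewrite /P2 andbA; apply: andb_id2r => /asboolP pCC.
  (* Edges inside [~: C] are automatically not inside [C]: otherwise they would be empty, with an
     empty trace, which [p] excludes. *)
  apply/andP/idP => [[]//|tCC]; split=> //; apply/allP => e et.
  apply/negP => eC; have e0 : e = set0.
    apply/eqP; rewrite -subset0 -(setICr C).
    by rewrite subsetI (eC : e \subset C) (allP tCC).
  have /negP[] : no_empty_edge
      (Hypergraph {x | x \in ~: C} (map (trace_edge (~: C)) t)).
    by apply: p_no_empty pCC; rewrite card_sig card_gt0.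
  apply/mapP; exists e => //; apply/setP => x.
  by rewrite e0 !inE.
rewrite -count_hypergraphs_induced //.
by apply: and_property p_property; exact: connected_property.
Qed.

(** Sets are grouped by their size [j]; [x \in C] forces [1 <= j], and [C != setT] forces
    [j < #|T|]. *)
Lemma sum_sets_containing (T : finType) (x : T) (G : nat -> nat) :
  (\sum_(C : {set T} | (x \in C) && (C != setT)) G #|C|
   = \sum_(1 <= j < #|T|) 'C(#|T|.-1, j.-1) * G j)%N.
Proof.
transitivity (\sum_(1 <= j < #|T|)
    \sum_(C : {set T} | (x \in C) && (j == #|C|)) G j)%N; last first.
  apply: eq_big_nat => -[//|j] _.
  rewrite -(card_sets_containing x) sum_nat_const.
  by congr (_ * _)%N; apply: eq_card => C; rewrite !inE eq_sym.
rewrite (exchange_big_dep (fun C : {set T} => x \in C)) /=; last first.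
  by move=> j C _ /andP[].
rewrite big_mkcondr; apply: eq_bigr => C xC.
rewrite (eq_bigl (fun j => j == #|C|)); last by move=> j; rewrite xC.
rewrite big_nat1_eq card_gt0 -cardsT.
have -> : C != set0 by apply/set0Pn; exists x.
by rewrite -properT properEcard subsetT.
Qed.

(** The subtraction-free form over [nat]: the first vertex is isolated, or its component is
    everything, or its component is proper. *)
Lemma count_hypergraphs_rec k p m n :
  hypergraph_property k p -> without_empty_edges p -> gamma_invariant p ->
  (alpha k p m n.+1 = alpha' k p m n.+1 + omega k p m n.+1
     + \sum_(1 <= i < m.+1) \sum_(1 <= j < n.+1)
         nu k m i * 'C(n, j.-1) * alpha k p (m - i) (n.+1 - j) * omega k p i j)%N.
Proof.
move=> pP p_no_empty p_gamma; apply/eqP; rewrite -(eqr_nat rat); apply/eqP.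
rewrite !natrD /alpha count_hypergraphs_ord //.
rewrite (bigID (fun t : m.-tuple {set 'I_n.+1} => adj t ord0 ord0)) /=.
rewrite addrC -addrA.
congr (_ + _).
  rewrite /alpha' count_hypergraphs_ord //; last first.
    by apply: and_property pP _; exact: first_isolated_property.
  apply: eq_bigl => t; apply/andP/asboolP => [[/asboolP pt t00]|[pt [v [v_min]]]].
    split=> //; exists ord0; split; first by move=> u; rewrite leEord.
    by apply/isolatedE.
  have -> : v = ord0.
    by apply/val_inj/eqP; rewrite -leqn0; have := v_min ord0; rewrite leEord.
  by move=> /isolatedE; split=> //; apply/asboolP.
(* The families whose first vertex is not isolated are sorted by its component; the component [setT]
   gives the connected ones. *)
rewrite (partition_big (fun t : m.-tuple _ => [set v | connect (adj t) ord0 v])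
  (fun C => ord0 \in C)) /=; last by move=> t _; rewrite inE.
rewrite (bigD1 setT) ?inE //=; congr (_ + _).
  rewrite /omega count_hypergraphs_ord //; last first.
    by apply: and_property pP; exact: connected_property.
  apply: eq_bigl => t.
  have cE := @connected_baseP (Hypergraph 'I_n.+1 t) ord0.
  apply/idP/asboolP.
    case/andP=> /andP[/asboolP pt t00] /eqP /setP tT.
    split=> //; apply/cE; split=> // v.
    by have := tT v; rewrite !inE.
  case=> /cE[t00 ct] pt; rewrite t00 andbT; apply/andP.
  split; first exact/asboolP.
  by apply/eqP/setP => v; rewrite !inE; apply: ct.
pose g i j := (nu k m i * alpha k p (m - i) (n.+1 - j) * omega k p i j)%N.
transitivity (\sum_(C : {set 'I_n.+1} | (ord0 \in C) && (C != setT))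
    \sum_(1 <= i < m.+1) (g i #|C|)%:R : rat).
  by apply: eq_bigr => C /andP[C_ord0 CT]; exact: sum_component.
rewrite exchange_big natr_sum; apply: eq_bigr => i _.
rewrite -natr_sum sum_sets_containing card_ord; congr (_%:R).
by apply: eq_bigr => j _; rewrite /g /= !mulnA (mulnC 'C(_, _)).
Qed.

Theorem theorem5p2 (k : kind) (p : hypergraph -> Prop)
    (p_property : hypergraph_property k p)
    (p_no_empty : without_empty_edges p)
    (p_gamma : gamma_invariant p)
    (m n : nat) (m_ge1 : (1 <= m)%N) (n_ge2 : (2 <= n)%N) :
  ((omega k p m n)%:Z =
     (alpha k p m n)%:Z - (alpha' k p m n)%:Z
     - \sum_(1 <= i < m.+1) \sum_(1 <= j < n)
         (nu k m i * 'C(n - 1, j - 1)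
            * alpha k p (m - i) (n - j) * omega k p i j)%N%:Z)%R.
Proof.
case: n n_ge2 => // n _.
under [in RHS]eq_bigr do under eq_bigr do rewrite !subn1.
rewrite (count_hypergraphs_rec m n p_property) //=.
(* The double sum is collected into one natural number, so that only a linear identity in the
   integers remains. *)
have -> (F : nat -> nat -> nat) :
    \sum_(1 <= i < m.+1) \sum_(1 <= j < n.+1) (F i j)%:Z
    = (\sum_(1 <= i < m.+1) \sum_(1 <= j < n.+1) F i j)%N%:Z.
  rewrite (big_morph Posz PoszD (erefl _)); apply: eq_bigr => i _.
  by rewrite (big_morph Posz PoszD (erefl _)).
by rewrite !PoszD; ring.
Qed.
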